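(* Let $C$ be a non-ambiguous class of tree-like tableaux. Then $\sum_{T\in C}oc(T)=|C|$; that is, on average there is exactly one occupied corner per tree-like tableau in $C$.
   Context: A tree-like tableau is a filling of a Young diagram (English convention) in which some cells contain a point, subject to: (1) the top-left cell contains a point; (2) for each other point, there is a point above it in the same column or a point to its left in the same row, but not both; (3) there is no empty row and no empty column. A non-ambiguous class is a maximal set of tree-like tableaux whose points are arranged in the same way, i.e. which have exactly the same set of point positions (row index counted from the top, column index counted from the left), while their underlying Young diagram shapes may differ. A corner is a cell whose bottom and right edges both lie on the Southeast boundary of the diagram; it is occupied if it contains a point; $oc(T)$ is the number of occupied corners of $T$. *)

(* Defs.v *)
From mathcomp Require Import all_boot finmap.
From mathcomp Require Import boolp classical_sets cardinality.

Set Implicit Arguments.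
Unset Strict Implicit.
Unset Printing Implicit Defensive.

Local Open Scope classical_set_scope.

(* A cell is a pair (row, column); rows are numbered from the top and columns *)
(* from the left, both starting at 0, so that (0, 0) is the top-left cell.    *)
Definition cell : choiceType := (nat * nat)%type.

(* Left-justified rows of weakly decreasing lengths, as a set of cells: a     *)
(* finite set closed under moving up and moving left.                         *)
Definition young_diagram (D : {fset cell}) : Prop :=
  forall i j i' j' : nat,
    i' <= i -> j' <= j -> (i, j) \in D -> (i', j') \in D.

Definition filling : choiceType := ({fset cell} * {fset cell})%type.

Definition shape (T : filling) : {fset cell} := T.1.
Definition points (T : filling) : {fset cell} := T.2.

Definition point_above (P : {fset cell}) (i j : nat) : Prop :=
  exists2 i' : nat, i' < i & (i', j) \in P.

Definition point_left (P : {fset cell}) (i j : nat) : Prop :=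
  exists2 j' : nat, j' < j & (i, j') \in P.

Record tree_like (T : filling) : Prop := TreeLike {
  tree_like_shape : young_diagram (shape T);
  tree_like_points : (points T `<=` shape T)%fset;
  tree_like_root : (0, 0) \in points T;
  tree_like_parent : forall i j : nat,
    (i, j) \in points T -> (i, j) <> (0, 0) ->
    (point_above (points T) i j \/ point_left (points T) i j) /\
    ~ (point_above (points T) i j /\ point_left (points T) i j);
  tree_like_row : forall i j : nat,
    (i, j) \in shape T -> exists j' : nat, (i, j') \in points T;
  tree_like_col : forall i j : nat,
    (i, j) \in shape T -> exists i' : nat, (i', j) \in points T
}.

Definition same_arrangement (C : set filling) : Prop :=
  (forall T, C T -> tree_like T) /\
  (forall T T', C T -> C T' -> points T = points T').

(* The empty set is not maximal, so a class is nonempty.                      *)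
Definition non_ambiguous_class (C : set filling) : Prop :=
  same_arrangement C /\
  forall C' : set filling, same_arrangement C' -> C `<=` C' -> C' = C.

Definition corner (D : {fset cell}) (c : cell) : bool :=
  [&& c \in D, (c.1.+1, c.2) \notin D & (c.1, c.2.+1) \notin D].

Definition oc (T : filling) : nat :=
  #|` [fset c in shape T | corner (shape T) c && (c \in points T)]|%fset.

(* Main.v *)
(* For a point set P, the class consists of the shapes D that are Young       *)
(* diagrams containing P all of whose rows and columns meet P. Fix a point    *)
(* c = (i, j). Adding one cell to every row below row i sends the shapes with *)
(* corner c bijectively onto the shapes D' in which c ends its row while no   *)
(* point of a lower row does. Each D' arises from exactly one c, namely the   *)
(* lowest point ending its row; one exists because every point of the last    *)
(* column ends its row. Double counting pairs (shape, occupied corner) gives  *)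
(* the result. In terms of boundary paths read from the southwest, this moves *)
(* an East step from the marked corner to the start of the path.              *)
Require Import Defs.
From mathcomp Require Import all_boot finmap.
From mathcomp Require Import boolp classical_sets cardinality.
From mathcomp Require Import zify.

Set Implicit Arguments.
Unset Strict Implicit.
Unset Printing Implicit Defensive.

Local Open Scope fset_scope.

(** Only [admissible] ties the shape to the points; the other tableau axioms concern [P] alone. So a
    class is [admissible_shapes P] for one [P] ([non_ambiguous_classE]). In [sum_oc_shapes],
    [card_corner_last_tight] replaces corners by last tight points, one point at a time, and
    [card_last_tight] finds exactly one of these in each shape. *)

Record admissible (P D : {fset cell}) : Prop := Admissible {
  admissible_young : young_diagram D;
  admissible_sub : P `<=` D;
  admissible_row : forall i j : nat,
    (i, j) \in D -> exists j' : nat, (i, j') \in P;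
  admissible_col : forall i j : nat,
    (i, j) \in D -> exists i' : nat, (i', j) \in P
}.

(** The cells whose row and column both meet [P]: a finite bound for all admissible shapes. *)
Definition box (P : {fset cell}) : {fset cell} :=
  [fset ((pq.1.1, pq.2.2) : cell) | pq in P `*` P].

Definition admissible_shapes (P : {fset cell}) : {fset {fset cell}} :=
  [fset D in fpowerset (box P) | `[< admissible P D >]].

Lemma admissible_shapesP (P D : {fset cell}) :
  reflect (admissible P D) (D \in admissible_shapes P).
Proof.
apply: (iffP idP) => [|aD]; rewrite !inE /=; first by case/andP=> _ /asboolP.
rewrite (asboolT aD) andbT fpowersetE; apply/fsubsetP => -[i j] Dij.
have [[j' Pj'] [i' Pi']] := (admissible_row aD Dij, admissible_col aD Dij).
by apply/imfsetP; exists ((i, j'), (i', j)); rewrite ?inE ?Pj' ?Pi'.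
Qed.

(* Intersecting with [box P] only serves to make the set finite; nonempty   *)
(* rows k > i become one cell longer since 0.-1 = 0.                          *)
Definition lengthen (P : {fset cell}) (i : nat) (D : {fset cell}) :=
  [fset x in box P | (x.1, if x.1 <= i then x.2 else x.2.-1) \in D].

Definition shorten (P : {fset cell}) (i : nat) (D : {fset cell}) :=
  [fset x in box P | (x.1, if x.1 <= i then x.2 else x.2.+1) \in D].

(** A point is tight when it is the last cell of its row; [c] is to be the lowest row's tight
    point. *)
Definition last_tight (P D : {fset cell}) (c : cell) : bool :=
  ((c.1, c.2.+1) \notin D) &&
  all (fun p : cell => (c.1 < p.1) ==> ((p.1, p.2.+1) \in D)) P.

Lemma last_tightP (P D : {fset cell}) (i j : nat) :
  reflect ((i, j.+1) \notin D /\
           forall k l : nat, (k, l) \in P -> i < k -> (k, l.+1) \in D)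
          (last_tight P D (i, j)).
Proof.
apply: (iffP andP) => -[Dij H]; split=> //.
  by move=> k l /(allP H) /= /implyP.
by apply/allP => -[k l] Pkl; apply/implyP; apply: H.
Qed.

Lemma mem_box (P D : {fset cell}) (i j : nat) : admissible P D ->
  (i, j) \in D -> (i, j) \in box P.
Proof.
move=> /admissible_shapesP; rewrite !inE fpowersetE => /andP[/fsubsetP DB _].
exact: DB.
Qed.

(** * The bijection for a fixed point *)

Section FixedCorner.
Variables (P : {fset cell}) (i j : nat).
Hypothesis Pij : (i, j) \in P.

Lemma lengthenE (D : {fset cell}) (k l : nat) :
  admissible P D -> corner D (i, j) ->
  ((k, l) \in lengthen P i D) = ((k, if k <= i then l else l.-1) \in D).
Proof.
move=> aD /and3P[/= Dij Di Dj]; rewrite !inE /=.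
apply/andb_idl => Dkl.
have [j' Pj'] := admissible_row aD Dkl.
suff [i' Pi'] : exists i' : nat, (i', l) \in P.
  by apply/imfsetP; exists ((k, j'), (i', l)); rewrite ?inE ?Pj' ?Pi'.
case: leqP Dkl => ki Dkl; first exact: (admissible_col aD Dkl).
(* Since [(i.+1, j)] is not in [D], a lower row reaches at most column [j] once lengthened, and
   those columns meet [P] because row [i] contains them. *)
have lj : l <= j.
  rewrite leqNgt; apply: contra Di => jl.
  by apply: (admissible_young aD) Dkl => //; lia.
exact: (admissible_col aD (admissible_young aD (leqnn i) lj Dij)).
Qed.

Lemma shortenE (D : {fset cell}) (k l : nat) : admissible P D ->
  ((k, l) \in shorten P i D) = ((k, if k <= i then l else l.+1) \in D).
Proof.
move=> aD; rewrite !inE /=; apply/andb_idl => Dkl.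
apply: (mem_box aD); apply: (admissible_young aD) Dkl => //.
by case: ifP.
Qed.

Lemma lengthen_admissible (D : {fset cell}) :
  admissible P D -> corner D (i, j) -> admissible P (lengthen P i D).
Proof.
move=> aD cD; have E := fun k l => @lengthenE D k l aD cD.
have yD := admissible_young aD.
split=> [k l k' l' kk ll||k l|k l].
- rewrite !E; case: (leqP k i) => ki Dkl.
    by rewrite (leq_trans kk ki); apply: yD Dkl.
  case: leqP => k'i; last by apply: yD Dkl => //; lia.
  case/and3P: cD => /= Dij Di _; apply: (yD) Dij => //.
  rewrite leqNgt; apply: contra Di => jl.
  by apply: yD Dkl => //; lia.
- apply/fsubsetP => -[k l] Pkl; rewrite E.
  have := fsubsetP (admissible_sub aD) _ Pkl; apply: yD => //.
  by case: ifP => // _; exact: leq_pred.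
- by rewrite E => /(admissible_row aD).
(* Columns of [box P] meet [P] by construction. *)
- rewrite in_fset => /andP[/imfsetP[[p [q1 q2]] /=] + [_ ->] _].
  by rewrite inE => /andP[_ Pq]; exists q1.
Qed.

Lemma lengthen_last_tight (D : {fset cell}) :
  admissible P D -> corner D (i, j) -> last_tight P (lengthen P i D) (i, j).
Proof.
move=> aD cD; apply/last_tightP; split.
  by rewrite lengthenE // leqnn; case/and3P: cD.
move=> k l Pkl ik; rewrite lengthenE // leqNgt ik /=.
exact: fsubsetP (admissible_sub aD) _ Pkl.
Qed.

(** No point below row [i] ends its row, so dropping the last cell of each lower row loses no
    point. *)
Lemma shorten_admissible (D : {fset cell}) :
  admissible P D -> last_tight P D (i, j) -> admissible P (shorten P i D).
Proof.
move=> aD /last_tightP[Dij tD]; have E := fun k l => @shortenE D k l aD.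
have yD := admissible_young aD.
have sub k l : (k, l) \in shorten P i D -> (k, l) \in D.
  by rewrite E; apply: yD => //; case: ifP.
split=> [k l k' l' kk ll||k l|k l].
- by rewrite !E; apply: yD => //; case: (leqP k i); case: (leqP k' i); lia.
- apply/fsubsetP => -[k l] Pkl; rewrite E; case: leqP => [_|]; last exact: tD.
  exact: fsubsetP (admissible_sub aD) _ Pkl.
- by move/sub/(admissible_row aD).
- by move/sub/(admissible_col aD).
Qed.

Lemma shorten_corner (D : {fset cell}) :
  admissible P D -> last_tight P D (i, j) -> corner (shorten P i D) (i, j).
Proof.
move=> aD /last_tightP[Dij tD]; rewrite /corner /= !shortenE // leqnn ltnn Dij.
rewrite (fsubsetP (admissible_sub aD) _ Pij) andbT /=.
(* If [(i.+1, j)] survived, then [(i.+1, j.+1)], and hence [(i, j.+1)], would lie in [D]. *)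
by apply: contra Dij; apply: (admissible_young aD).
Qed.

Lemma lengthenK (D : {fset cell}) : admissible P D -> corner D (i, j) ->
  shorten P i (lengthen P i D) = D.
Proof.
move=> aD cD; apply/fsetP => -[k l].
rewrite shortenE ?lengthenE //; last exact: lengthen_admissible.
by case: leqP.
Qed.

Lemma shortenK (D : {fset cell}) : admissible P D -> last_tight P D (i, j) ->
  lengthen P i (shorten P i D) = D.
Proof.
move=> aD tD; apply/fsetP => -[k l].
rewrite lengthenE ?shortenE //;
  [|exact: shorten_admissible|exact: shorten_corner].
case: leqP => // ik; case: l => // /=.
(* In column 0, where [0.-1 = 0], a nonempty lower row must have length at least 2: it contains a
   point, which does not end it. *)
apply/idP/idP => [|D0]; first exact: (admissible_young aD).
have [l' Pl'] := admissible_row aD D0.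
have [_ /(_ _ _ Pl' ik)] := last_tightP _ _ _ _ tD.
exact: (admissible_young aD).
Qed.

Lemma card_corner_last_tight :
  #|` [fset D in admissible_shapes P | corner D (i, j)]| =
  #|` [fset D in admissible_shapes P | last_tight P D (i, j)]|.
Proof.
set A := [fset D in _ | corner _ _]; set B := [fset D in _ | last_tight _ _ _].
have AP D : reflect (admissible P D /\ corner D (i, j)) (D \in A).
  rewrite in_fset; apply: (iffP andP) => -[].
    by move=> /admissible_shapesP.
  by move=> /admissible_shapesP.
have BP D : reflect (admissible P D /\ last_tight P D (i, j)) (D \in B).
  rewrite in_fset; apply: (iffP andP) => -[].
    by move=> /admissible_shapesP.
  by move=> /admissible_shapesP.
suff -> : B = lengthen P i @` A.
  rewrite [RHS]card_in_imfset // => D D' /AP[aD cD] /AP[aD' cD'] eqDD'.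
  by rewrite -(lengthenK aD cD) eqDD' lengthenK.
apply/fsetP => D; apply/BP/imfsetP => [[aD tD]|[D' /AP[aD' cD'] ->]].
  exists (shorten P i D); last by rewrite shortenK.
  by apply/AP; split; [exact: shorten_admissible|exact: shorten_corner].
by split; [exact: lengthen_admissible|exact: lengthen_last_tight].
Qed.

End FixedCorner.

(** * Uniqueness of the last tight point *)

Lemma exists_max_seq (T : eqType) (f : T -> nat) (s : seq T) (x : T) : x \in s ->
  exists2 y, y \in s & forall z, z \in s -> f z <= f y.
Proof.
elim: s x => // a s IHs x _; case: s IHs => [|b s] IHs.
  by exists a; rewrite ?mem_head // => z; rewrite inE => /eqP->.
have [y sy ymax] := IHs b (mem_head _ _).
have [ya|/ltnW ay] := leqP (f y) (f a).
  exists a; first exact: mem_head.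
  move=> z; rewrite inE => /predU1P[->//|/ymax zy].
  exact: leq_trans zy ya.
exists y; first by rewrite inE sy orbT.
by move=> z; rewrite inE => /predU1P[->//|/ymax].
Qed.

Lemma card_last_tight (P D : {fset cell}) (c0 : cell) : c0 \in P ->
  admissible P D -> #|` [fset c in P | last_tight P D c]| = 1.
Proof.
move=> Pc0 aD.
have [[m1 m2] /= Pm mmax] := exists_max_seq (fun c : cell => c.2) Pc0.
(* A cell to the right would force a point in column [m2.+1], beyond the rightmost point. *)
have Qm : (m1, m2) \in [seq c : cell <- P | (c.1, c.2.+1) \notin D].
  rewrite mem_filter Pm andbT /=; apply/negP => /(admissible_col aD)[k Pk].
  by have /= := mmax _ Pk; rewrite ltnn.
have [[i j]] := exists_max_seq (fun c : cell => c.1) Qm.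
rewrite mem_filter /= => /andP[Dij Pij] ijmax.
suff -> : [fset c in P | last_tight P D c] = [fset (i, j)] by rewrite cardfs1.
have tij k l : (k, l) \in P -> i < k -> (k, l.+1) \in D.
  move=> Pkl; apply: contraTT => Dkl; rewrite -leqNgt.
  by apply: (ijmax (k, l)); rewrite mem_filter Dkl.
apply/fsetP => -[k l]; rewrite in_fset in_fset1.
apply/andP/eqP => [[Pkl /last_tightP[Dkl tkl]]|[-> ->]]; last first.
  by split=> //; apply/last_tightP.
(* Two last tight points share a row, as neither can lie below the other. *)
have ki : k = i.
  apply/eqP; rewrite eqn_leq leqNgt (contra (tij _ _ Pkl) Dkl) /=.
  by rewrite leqNgt (contra (tkl _ _ Pij) Dij).
rewrite {}ki in Pkl Dkl *.
have below a b : (i, a) \in P -> (i, b.+1) \notin D -> a <= b.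
  move=> Pa; apply: contraNleq => ba.
  by apply: (admissible_young aD) (fsubsetP (admissible_sub aD) _ Pa).
by congr (_, _); apply/eqP; rewrite eqn_leq !below.
Qed.

Lemma card_fset_filter (T : choiceType) (A : {fset T}) (Q : pred T) :
  #|` [fset x in A | Q x]| = \sum_(x <- A) Q x.
Proof.
rewrite card_fset_sum1 -big_fset_condE big_mkcond /=.
by apply: eq_bigr => x _; case: (Q x).
Qed.

Lemma sum_oc_shapes (P : {fset cell}) (c0 : cell) : c0 \in P ->
  \sum_(D <- admissible_shapes P) oc (D, P) = #|` admissible_shapes P|.
Proof.
move=> Pc0; set S := admissible_shapes P.
transitivity (\sum_(D <- S) \sum_(c <- P) corner D c).
  apply: eq_big_seq => D /admissible_shapesP aD.
  rewrite -card_fset_filter; congr #|` _|; apply/fsetP => c.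
  rewrite !in_fset; apply/and3P/andP => [[_ -> ->]//|[-> cD]].
  by split=> //; case/and3P: cD.
rewrite exchange_big /= card_fset_sum1.
transitivity (\sum_(c <- P) \sum_(D <- S) last_tight P D c).
  apply: eq_big_seq => -[i j] Pij.
  by rewrite -!card_fset_filter card_corner_last_tight.
rewrite exchange_big; apply: eq_big_seq => D /admissible_shapesP aD.
by rewrite -card_fset_filter (card_last_tight Pc0).
Qed.

(** * Classes as sets of shapes *)

Lemma tree_like_admissible (T : filling) :
  tree_like T -> admissible (points T) (Defs.shape T).
Proof. by case. Qed.

Lemma admissible_tree_like (P D D' : {fset cell}) :
  tree_like (D, P) -> admissible P D' -> tree_like (D', P).
Proof. by case=> _ _ P0 par _ _ [yD' PD' row col]; split. Qed.

Lemma tree_like_single : tree_like ([fset (0, 0)], [fset (0, 0)]).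
Proof.
split=> //=.
- move=> i j i' j' ii jj; rewrite !inE => /eqP[ei ej]; apply/eqP.
  by congr (_, _); lia.
- by rewrite inE.
- by move=> i j; rewrite inE => /eqP.
- by move=> i j Dij; exists j.
- by move=> i j Dij; exists i.
Qed.

Lemma non_ambiguous_classE (C : set filling) : non_ambiguous_class C ->
  exists2 T, tree_like T &
    C = [set` [fset ((D, points T) : filling) | D in admissible_shapes (points T)]]%classic.
Proof.
move=> [[treeC ptC] maxC].
have [T CT] : exists T, C T.
  (* An empty [C] would be properly contained in the arrangement formed by the one-cell tableau. *)
  apply: contrapT => C0.
  pose T0 : filling := ([fset (0, 0)], [fset (0, 0)]).
  have eqC : [set T0]%classic = C.
    apply: maxC => [|T CT]; last by case: C0; exists T.
    split=> [T ->|T T' -> ->] //; exact: tree_like_single.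
  by apply: C0; exists T0; rewrite -eqC.
have trT := treeC T CT; exists T => //; apply/esym/maxC.
  split=> [T'|T' T''] /=.
    case/imfsetP=> D /admissible_shapesP aD ->.
    by case: (T) trT aD => E P; apply: admissible_tree_like.
  by move=> /imfsetP[D _ ->] /imfsetP[D' _ ->].
move=> T' CT'; apply/imfsetP; exists (Defs.shape T').
  apply/admissible_shapesP; rewrite (ptC _ _ CT CT').
  exact/tree_like_admissible/treeC.
by rewrite (ptC _ _ CT CT'); case: (T').
Qed.

Theorem theorem3p8 (C : set filling) (hC : non_ambiguous_class C) :
  finite_set C /\
  \sum_(T <- fset_set C) oc T = #|` fset_set C|%fset.
Proof.
have [T trT ->] := non_ambiguous_classE hC; split; first exact: finite_fset.
rewrite set_fsetK.
have inj : injective (fun D : {fset cell} => (D, points T) : filling).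
  by move=> D D' [].
rewrite card_imfset // big_imfset /=; last by move=> D D' _ _; apply: inj.
exact: sum_oc_shapes (tree_like_root trT).
Qed.
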